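(* There is an absolute constant $c>0$ such that the following holds. Let $b_{1},\ldots,b_{k}$ be distinct integers, $a\in\mathbb{N}$, $s\in\mathbb{N}$. Let $k\geq 2$, $x\geq 3$, $(\log x)^{-9/10}\leq \eta\leq 1$, and $|b_{i}|\leq \log x$ for all $1\leq i\leq k$. Set $f(b)=(b-b_{1})\cdots(b-b_{k})$. Then: 1) If $k\geq \log\log x$ or $s\leq k$, then \[ \sum_{\substack{b\in\mathbb{Z},\ |b|\leq \eta\log x\\ b\neq b_{1},\ldots,b_{k}}}\Big(\frac{a^{k+1}|f(b)|}{\varphi(a^{k+1}|f(b)|)}\Big)^{s}\leq \Big(c\,\frac{a}{\varphi(a)}\log k\Big)^{s}\eta\log x . \] 2) If $2\leq k<\log\log x$ and $s>k$, then \[ \sum_{\substack{b\in\mathbb{Z},\ |b|\leq \eta\log x\\ b\neq b_{1},\ldots,b_{k}}}\Big(\frac{a^{k+1}|f(b)|}{\varphi(a^{k+1}|f(b)|)}\Big)^{s}\leq \Big(c\,\frac{a}{\varphi(a)}\log s\Big)^{s}\eta\log x . \]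
   Context: $\varphi$ denotes Euler's totient function; $\log$ is the natural logarithm; $\mathbb{N}$ is the set of positive integers. *)

(* Defs.v *)
From mathcomp Require Import all_boot all_order all_algebra.
From mathcomp Require Import all_classical all_reals all_analysis.

Set Implicit Arguments.
Unset Strict Implicit.
Unset Printing Implicit Defensive.

Import Order.TTheory GRing.Theory Num.Theory.
Local Open Scope classical_set_scope.
Local Open Scope ring_scope.

Definition root_prod (k : nat) (bs : 'I_k -> int) (b : int) : int :=
  \prod_(i < k) (b - bs i).

Definition totient_ratio (R : realType) (n : nat) : R :=
  n%:R / (totient n)%:R.

Definition sum_range (R : realType) (k : nat) (bs : 'I_k -> int) (y : R) :
    set int :=
  [set b : int | `|b%:~R| <= y /\ forall i, b <> bs i].

(* The set of indices is finite, so the finitely supported sum over it, which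
   defaults to 0 on an infinite support, is the ordinary sum. *)
Definition totient_sum (R : realType) (k : nat) (bs : 'I_k -> int)
    (a s : nat) (y : R) : R :=
  \sum_(b \in sum_range bs y)
    totient_ratio R (a ^ k.+1 * `|root_prod bs b|)%N ^+ s.

(* Main.v *)
Require Import Defs.
From mathcomp Require Import all_boot all_order all_algebra.
From mathcomp Require Import all_classical all_reals all_analysis.
From mathcomp Require Import ring lra zify.

Import Order.TTheory GRing.Theory Num.Theory.
Local Open Scope ring_scope.

(** Write r_p = (1 - 1/p)^-1, so that n / phi(n) is the product of r_p over the
primes p | n, and put l = log log x, y = eta log x >= exp(l / 10),
K = max(k, s) (or K = k when l <= k).

The primes p <= K contribute O(log K) to f(b) / phi(f(b)) by Mertens' upper
bound.  As |f(b)| <= (2 log x)^k, f(b) has O(k (1 + l)) prime factors.  Let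
W = k^2, V = k if l <= k, and W of order l^2, V of order sqrt l otherwise.  Then
log W = O(log V), so the primes p > V contribute only O(1): those up to W
because the sum of 1/p over V < p <= W is at most
(1 / log V) (sum of (log p)/p over p <= W) = O(1), the others because there are
only O(W) of them.

The primes K < p <= V, which occur only if l > k, are treated on average over
b: their product P is at most V! <= exp(V^2) <= y, so [-y, y] is covered by
O(y / P) complete residue systems mod P, over which the sum of
prod_(p | f(b)) r_p^s factors by the Chinese remainder theorem.  At most k of
the p residues mod p make p divide f(b), and r_p^s = 1 + O(s / p), so the mean
value is at most prod_(p > K) (1 + O(k s / p^2)) <= exp(O(k s / K)) <= exp(O(s)). *)

(** * Euler factors and their relation to n / phi(n) *)

Definition euler_factor (R : realType) (p : nat) : R := (1 - p%:R^-1)^-1.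

Lemma euler_factorE (R : realType) (p : nat) :
  (1 < p)%N -> euler_factor R p = p%:R / p.-1%:R.
Proof.
case: p => [//|[//|p]] _ /=; rewrite /euler_factor -[p.+2%:R]natr1.
have : 0 < p.+1%:R :> R by [].
move: p.+1%:R => q q0; field; apply/andP; split; lra.
Qed.

Lemma euler_factor_ge1 (R : realType) (p : nat) :
  (1 < p)%N -> 1 <= euler_factor R p.
Proof.
move=> p1; rewrite euler_factorE // ler_pdivlMr ?mul1r ?ler_nat ?leq_pred //.
by rewrite ltr0n -subn1 subn_gt0.
Qed.

(** The factor is 1 + 1 / (p - 1), and 1 / (p - 1) <= 2 / p for p >= 2. *)
Lemma euler_factor_le_expR (R : realType) (p : nat) :
  (1 < p)%N -> euler_factor R p <= expR (2 / p%:R).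
Proof.
case: p => [//|[//|p]] _; rewrite euler_factorE //= -[p.+2%:R]natr1.
have : 1 <= p.+1%:R :> R by rewrite ler1n.
move: p.+1%:R => q q1; apply: (le_trans _ (expR_ge1Dx _)).
rewrite ler_pdivrMr; last lra.
have q0 : 0 < q + 1 by lra.
have : 2 / (q + 1) * (q + 1) = 2 by rewrite divfK // gt_eqF.
have : 2 / (q + 1) <= 1 by rewrite ler_pdivrMr //; lra.
move: (2 / _) => t; nra.
Qed.

Lemma totient_ratio_primes (R : realType) (n : nat) :
  (0 < n)%N -> totient_ratio R n = \prod_(p <- primes n) euler_factor R p.
Proof.
move=> n0; rewrite /totient_ratio {1}(prod_prime_decomp n0) totientE //.
rewrite prime_decompE big_map /= !natr_prod -prodf_div.
apply: eq_big_seq => p pn; move: (pn); rewrite mem_primes => /andP[pp _].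
have p1 := prime_gt1 pp.
rewrite euler_factorE //.
have := pn; rewrite -logn_gt0; case: (logn p n) => // l _ /=.
rewrite expnS !natrM -mulf_div divff ?mulr1 // natrX expf_neq0 //.
by rewrite pnatr_eq0 -lt0n prime_gt0.
Qed.

Lemma perm_cat_filterC (T : eqType) (s t : seq T) :
  uniq s -> uniq t -> {subset s <= t} ->
  perm_eq t (s ++ [seq x <- t | x \notin s]).
Proof.
move=> us ut st; apply: uniq_perm => //.
  rewrite cat_uniq us filter_uniq // andbT /=; apply/hasPn => x.
  by rewrite mem_filter => /andP[].
move=> x; rewrite mem_cat mem_filter; case: (boolP (x \in s)) => //= xs.
exact: st.
Qed.

Lemma ler_prod_subset (R : realType) (T : eqType) (s t : seq T) (f : T -> R) :
  uniq s -> uniq t -> {subset s <= t} -> {in t, forall x, 1 <= f x} ->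
  \prod_(x <- s) f x <= \prod_(x <- t) f x.
Proof.
move=> us ut st f1.
rewrite (perm_big _ (@perm_cat_filterC _ _ _ us ut st)) /= big_cat /=.
have s0 : 0 <= \prod_(x <- s) f x.
  by rewrite big_seq; apply: prodr_ge0 => x xs; apply: le_trans (f1 x (st _ xs)).
rewrite -{1}[X in X <= _]mulr1 ler_wpM2l // big_seq.
elim/big_rec: _ => // x y; rewrite mem_filter => /andP[_ xt] y1.
by rewrite mulr_ege1 // f1.
Qed.

Lemma ler_sum_subset (R : realType) (T : eqType) (s t : seq T) (f : T -> R) :
  uniq s -> uniq t -> {subset s <= t} -> {in t, forall x, 0 <= f x} ->
  \sum_(x <- s) f x <= \sum_(x <- t) f x.
Proof.
move=> us ut st f0.
rewrite (perm_big _ (@perm_cat_filterC _ _ _ us ut st)) /= big_cat /=.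
rewrite lerDl big_seq; apply: sumr_ge0 => x.
by rewrite mem_filter => /andP[_ /f0].
Qed.

Lemma prod_euler_factor_ge1 (R : realType) (n : nat) (P : pred nat) :
  1 <= \prod_(p <- primes n | P p) euler_factor R p.
Proof.
rewrite big_seq_cond; elim/big_rec: _ => // p y.
rewrite mem_primes => /andP[/andP[/prime_gt1 p1 _] _] y1.
by rewrite mulr_ege1 // euler_factor_ge1.
Qed.

Lemma totient_ratio_ge1 (R : realType) (n : nat) :
  (0 < n)%N -> 1 <= totient_ratio R n.
Proof. by move=> n0; rewrite totient_ratio_primes //; exact: prod_euler_factor_ge1. Qed.

(** The primes of m n are those of m together with the remaining ones of n; a common prime occurs
    twice on the right, with a factor at least 1. *)
Lemma totient_ratioM (R : realType) (m n : nat) : (0 < m)%N -> (0 < n)%N ->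
  totient_ratio R (m * n) <= totient_ratio R m * totient_ratio R n.
Proof.
move=> m0 n0; rewrite !totient_ratio_primes ?muln_gt0 ?m0 //.
rewrite [X in _ <= _ * X](bigID (mem (primes m))) /=.
set A := \prod_(p <- primes m) _; set B := (X in _ <= _ * (X * _)).
set C := (X in _ <= _ * (_ * X)).
apply: (@le_trans _ _ (A * C)).
  rewrite /A /C -[X in _ <= _ * X]big_filter -big_cat /=.
  apply: ler_prod_subset; rewrite ?primes_uniq //.
  - rewrite cat_uniq primes_uniq filter_uniq ?primes_uniq // andbT /=.
    by apply/hasPn => p; rewrite mem_filter => /andP[].
  - move=> p; rewrite primesM // mem_cat mem_filter.
    by case: (p \in primes m).
  move=> p; rewrite mem_cat mem_filter !mem_primes.
  by case/orP=> [/andP[]|/andP[_ /andP[]]] /prime_gt1 p1 _; exact: euler_factor_ge1.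
have A1 : 1 <= A by exact: prod_euler_factor_ge1.
rewrite ler_wpM2l ?(le_trans _ A1) // ler_peMl //; last exact: prod_euler_factor_ge1.
by apply: le_trans ler01 _; exact: prod_euler_factor_ge1.
Qed.

(** Only the set of prime divisors matters; this keeps the exponent [k.+1] of [a] out of the final
    bound. *)
Lemma totient_ratioX (R : realType) (m n : nat) : (0 < m)%N -> (0 < n)%N ->
  totient_ratio R (m ^ n) = totient_ratio R m.
Proof. by move=> m0 n0; rewrite !totient_ratio_primes ?expn_gt0 ?m0 // primesX. Qed.

(** * Elementary bounds for logarithms, factorials and harmonic sums *)

Lemma ln_prod_seq (R : realType) (T : eqType) (s : seq T) (f : T -> R) :
  {in s, forall x, 0 < f x} ->
  ln (\prod_(x <- s) f x) = \sum_(x <- s) ln (f x).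
Proof.
move=> f0; rewrite -[RHS]expRK expR_sum; congr ln.
by apply: eq_big_seq => x xs; rewrite lnK // posrE f0.
Qed.

Lemma ln_nat_ge0 (R : realType) (n : nat) : 0 <= ln (n%:R : R).
Proof. by case: n => [|n]; [rewrite ln0 | rewrite ln_ge0 ?ler1n]. Qed.

(** Take t = -1/2 in log (1 + t) <= t. *)
Lemma half_le_ln2 (R : realType) : 2^-1 <= ln (2 : R).
Proof.
have := @le_ln1Dx R (- 2^-1) ltac:(lra).
have -> : 1 + - 2^-1 = 2^-1 :> R by lra.
rewrite lnV ?posrE //; lra.
Qed.

Lemma half_le_ln_nat (R : realType) (n : nat) : (1 < n)%N -> 2^-1 <= ln (n%:R : R).
Proof.
move=> n1; apply: (le_trans (half_le_ln2 R)).
by rewrite ler_ln ?posrE ?ltr0n ?ler_nat //; lia.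
Qed.

Lemma leq_fact_exp (n : nat) : (n`! <= n ^ n)%N.
Proof.
rewrite fact_prod -[X in (_ <= _ ^ X)%N](subn1 n.+1) -prod_nat_const_nat.
by rewrite !big_nat; apply: leq_prod => i /andP[_]; rewrite ltnS.
Qed.

(* p^(n %/ p) divides n`!, and n / p <= 2 (n %/ p) for p <= n, so a factor 2 is
   the only price for avoiding Chebyshev's bound. *)
Lemma sum_ln_prime_div (R : realType) (n : nat) : (0 < n)%N ->
  \sum_(0 <= p < n.+1 | prime p) ln p%:R / p%:R <= 2 * ln (n%:R : R).
Proof.
move=> n0.
have nR : 0 < n%:R :> R by rewrite ltr0n.
have lnfact : ln (n`!%:R : R) =
    \sum_(p <- primes n`!) (logn p n`!)%:R * ln (p%:R : R).
  rewrite {1}(prod_prime_decomp (fact_gt0 n)) prime_decompE big_map natr_prod.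
  rewrite ln_prod_seq => [|p].
    apply: eq_big_seq => p; rewrite mem_primes => /andP[/prime_gt0 p0 _].
    by rewrite natrX lnXn ?ltr0n // mulr_natl.
  by rewrite mem_primes => /andP[/prime_gt0 p0 _]; rewrite natrX exprn_gt0 ?ltr0n.
have le1 : \sum_(p <- [seq p <- index_iota 0 n.+1 | prime p])
    (logn p n`!)%:R * ln (p%:R : R) <= ln (n`!%:R : R).
  rewrite lnfact; apply: ler_sum_subset.
  - by rewrite filter_uniq ?iota_uniq.
  - exact: primes_uniq.
  - move=> p; rewrite mem_filter mem_index_iota mem_primes ltnS => /and3P[pp _ pn].
    by rewrite pp fact_gt0 dvdn_fact // prime_gt0.
  by move=> p _; rewrite mulr_ge0 ?ln_nat_ge0.
rewrite big_filter in le1.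
have le2 : ln (n`!%:R : R) <= n%:R * ln n%:R.
  rewrite mulr_natl -lnXn // -natrX ler_ln ?posrE ?ltr0n ?fact_gt0 ?expn_gt0 ?n0 //.
  by rewrite ler_nat leq_fact_exp.
rewrite -(ler_pM2l nR) mulrCA.
apply: (le_trans _ (ler_wpM2l _ (le_trans le1 le2))) => //.
rewrite !mulr_sumr big_nat_cond [leRHS]big_nat_cond.
apply: ler_sum => p /andP[/andP[_ pn] pp].
have p0 := prime_gt0 pp.
rewrite mulrCA mulrC [leRHS]mulrA; apply: ler_wpM2r; first exact: ln_nat_ge0.
rewrite ler_pdivrMr ?ltr0n // -!natrM ler_nat.
have : (n %/ p <= logn p n`!)%N.
  rewrite logn_fact // big_ltn; last by rewrite ltnS; lia.
  by rewrite expn1 leq_addr.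
have := divn_eq n p; have := ltn_pmod n p0.
have : (0 < n %/ p)%N by rewrite divn_gt0.
nia.
Qed.

(** Induction, with 1 / (n + 1) <= - log (1 - 1 / (n + 1)) = log (n + 1) - log n. *)
Lemma harmonic_le (R : realType) (n : nat) : (0 < n)%N ->
  \sum_(1 <= i < n.+1) (i%:R : R)^-1 <= 1 + ln n%:R.
Proof.
elim: n => [//|[_ _|n /(_ isT) IH _]].
  by rewrite big_nat1 ln1 invr1 addr0.
rewrite big_nat_recr //=; apply: (le_trans (lerD IH (lexx _))).
rewrite -addrA lerD2l.
have h : 0 < n.+1%:R / n.+2%:R :> R by rewrite divr_gt0.
have e : n.+1%:R / n.+2%:R = 1 + - (n.+2%:R)^-1 :> R.
  by rewrite -[in LHS](addrK 1 (n.+1%:R)) natr1 mulrBl divff // mul1r.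
have := @le_ln1Dx R (- n.+2%:R^-1).
rewrite -e ltrN2 invf_lt1 // ltr1n => /(_ isT).
by rewrite ln_div ?posrE // => ?; rewrite -lerBrDl -lerN2 opprB.
Qed.

(** * Mertens' upper bound for the product of Euler factors *)

Lemma prime_dvd_prod_set (n p : nat) (J : {set 'I_n}) :
  prime p -> (forall j, j \in J -> prime j) ->
  (p %| \prod_(j in J) j)%N -> exists2 j, j \in J & p = j :> nat.
Proof.
move=> pp Jp.
rewrite (big_morph _ (fun m1 m2 => Euclid_dvdM m1 m2 pp) (Euclid_dvd1 pp)).
rewrite big_has_cond => /hasP[j _ /andP[jJ]].
by rewrite dvdn_prime2 ?Jp // => /eqP; exists j.
Qed.

(** A set of primes is recovered from its product as the set of prime divisors. *)
Lemma prod_prime_set_inj (n : nat) (J J' : {set 'I_n}) :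
  (forall j, j \in J -> prime j) -> (forall j, j \in J' -> prime j) ->
  (\prod_(j in J) j = \prod_(j in J') j)%N -> J = J'.
Proof.
move=> pJ pJ' e.
have sub (A B : {set 'I_n}) : (forall j, j \in A -> prime j) ->
    (forall j, j \in B -> prime j) ->
    (\prod_(j in A) j = \prod_(j in B) j)%N -> A \subset B.
  move=> pA pB eAB; apply/fintype.subsetP => i iA.
  have [|j jB /val_inj -> //] := @prime_dvd_prod_set _ i B (pA _ iA) pB.
  by rewrite -eAB (bigD1 i) //= dvdn_mulr.
by apply/eqP; rewrite finset.eqEsubset !sub.
Qed.

(** Expand the product of the [F j + (j != i)%:R]: the second term vanishes only at [i], which kills
    exactly the sets [J] avoiding [i]. *)
Lemma sum_prod_mem (R : comRingType) (I : finType) (F : I -> R) (i : I) :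
  \sum_(J : {set I} | i \in J) \prod_j (if j \in J then F j else 1) =
  F i * \prod_(j | j != i) (F j + 1).
Proof.
have := @bigA_distr R 0 1 *%R +%R I F (fun j => (j != i)%:R) => /=.
rewrite (bigD1 i) //= eqxx addr0.
under eq_bigr => j ji do rewrite ji.
move=> ->; rewrite big_mkcond; apply: eq_bigr => J _.
case: ifPn => iJ.
  apply: eq_bigr => j _; case: ifPn => // jJ.
  by rewrite (_ : j != i) //; apply: contraNneq jJ => ->.
by rewrite (bigD1 i) //= (negbTE iJ) eqxx mul0r.
Qed.

(* Expand the product as T = sum_J 1/N(J), with J ranging over the sets of primes
   up to z and N(J) the product of J.  The average of log N(J) for the weights
   1/N(J) is at most sum_(p <= z) (log p)/p <= 2 log z, so by Markov's inequality
   the J with N(J) <= z^4 carry at least half of T; since N is injective, their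
   total weight is at most a harmonic sum. *)
Lemma prod_1D_prime_inv_le (R : realType) (z : nat) : (1 < z)%N ->
  \prod_(0 <= p < z.+1 | prime p) (p%:R^-1 + 1) <= 2 + 8 * ln (z%:R : R).
Proof.
move=> z1; have z0 : (0 < z)%N by lia.
(* Since [F] vanishes off the primes, [w J] is 1/N(J) for a set of primes and 0 for any other
   set. *)
pose F (i : 'I_z.+1) : R := if prime i then i%:R^-1 else 0.
pose w (J : {set 'I_z.+1}) := \prod_i (if i \in J then F i else 1).
pose T := \prod_(i < z.+1) (F i + 1).
pose lam (J : {set 'I_z.+1}) : R := \sum_(i in J) ln i%:R.
have F0 i : 0 <= F i by rewrite /F; case: ifP => // _; rewrite invr_ge0.
have w0 J : 0 <= w J by apply: prodr_ge0 => i _; case: ifP.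
have -> : \prod_(0 <= p < z.+1 | prime p) (p%:R^-1 + 1) = T.
  rewrite big_mkcond big_mkord; apply: eq_bigr => i _.
  by rewrite /F; case: ifP => // _; rewrite add0r.
have TE : T = \sum_J w J.
  by rewrite /T (@bigA_distr R 0 1 *%R +%R _ F (fun=> 1)).
have T0 : 0 <= T by rewrite TE sumr_ge0.
(* Exchange the sums: by [sum_prod_mem], the sets containing [i] have total weight at most
   [F i * T]. *)
have moment : \sum_J w J * lam J <= 2 * ln z%:R * T.
  have -> : \sum_J w J * lam J =
      \sum_(i < z.+1) ln i%:R * \sum_(J : {set 'I_z.+1} | i \in J) w J.
    under eq_bigr => J _ do rewrite mulr_sumr big_mkcond /=.
    rewrite exchange_big /=; apply: eq_bigr => i _.
    rewrite mulr_sumr [RHS]big_mkcond /=; apply: eq_bigr => J _.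
    by case: ifP => // _; rewrite mulrC.
  apply: (@le_trans _ _ (\sum_(i < z.+1) ln i%:R * (F i * T))).
    apply: ler_sum => i _; rewrite ler_wpM2l ?ln_nat_ge0 //.
    rewrite sum_prod_mem ler_wpM2l // /T [leRHS](bigD1 i) //=.
    rewrite ler_peMl ?lerDr //; apply: prodr_ge0 => j _.
    by rewrite addr_ge0.
  under eq_bigr => i _ do rewrite mulrA.
  rewrite -mulr_suml ler_wpM2r //.
  apply: (le_trans _ (@sum_ln_prime_div R z z0)).
  rewrite [leRHS]big_mkcond big_mkord; apply: ler_sum => i _.
  by rewrite /F; case: ifP => // _; rewrite mulr0.
pose X := (z ^ 4)%N.
have X0 : (0 < X)%N by rewrite expn_gt0 z0.
pose good :=
  [set J : {set 'I_z.+1} | [forall i in J, prime i] && (\prod_(i in J) i <= X)%N].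
have lnX : ln (X%:R : R) = 4 * ln z%:R by rewrite natrX lnXn ?ltr0n // mulr_natl.
have lnz : 2^-1 <= ln (z%:R : R) by exact: half_le_ln_nat.
have goodE J : J \in good -> w J = (\prod_(i in J) i)%:R^-1.
  rewrite inE => /andP[/forall_inP pJ _]; rewrite natr_prod -prodfV /w.
  rewrite [RHS]big_mkcond; apply: eq_bigr => i _; case: ifP => // iJ.
  by rewrite /F pJ.
(* The weighted sum of [4 * ln z%:R - lam J] is at least 2 T log z, and the sets outside [good]
   contribute nonpositive terms to it. *)
have key : 2 * ln z%:R * T <= 4 * ln z%:R * \sum_(J in good) w J.
  have : 2 * ln z%:R * T <= \sum_J w J * (4 * ln z%:R - lam J).
    under eq_bigr => J _ do rewrite mulrBr.
    rewrite sumrB -mulr_suml -TE; move: moment; move: (\sum_J _) => U; lra.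
  move/le_trans; apply; rewrite mulr_sumr [leRHS]big_mkcond.
  apply: ler_sum => J _; case: ifPn => Jgood.
    rewrite mulrC ler_wpM2r //.
    by rewrite gerBl sumr_ge0 // => i _; exact: ln_nat_ge0.
  move: Jgood; rewrite inE negb_and => /orP[|].
    move/forall_inPn => [i iJ pi].
    by rewrite /w (bigD1 i) //= iJ /F (negbTE pi) !mul0r.
  rewrite -ltnNge => XJ; apply: mulr_ge0_le0 => //.
  rewrite subr_le0 -lnX.
  (* An element 0 would make the product 0, against [XJ]; without it all factors are positive and
     [lam J] is the logarithm of the product. *)
  case: (boolP [exists i in J, i == 0 :> nat]) => [/existsP[i /andP[iJ /eqP i0]]|].
    move: XJ; rewrite (bigD1 i) //=.
    by rewrite i0 mul0n.
  move=> /exists_inPn J0.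
  have <- : ln (\prod_(i in J) i)%:R = lam J :> R.
    rewrite natr_prod -big_enum ln_prod_seq /=; first by rewrite big_enum.
    by move=> i; rewrite mem_enum => /J0; rewrite ltr0n lt0n.
  rewrite ler_ln ?posrE ?ltr0n ?ler_nat //; first exact: ltnW.
  exact: leq_ltn_trans XJ.
have Tle : T <= 2 * \sum_(J in good) w J.
  by move: key; move: (\sum_(J in good) w J) => U; nra.
apply: (le_trans Tle).
have -> : 2 + 8 * ln z%:R = 2 * (1 + ln (X%:R : R)) by rewrite lnX; lra.
rewrite ler_pM2l //; apply: (le_trans _ (@harmonic_le R X X0)).
rewrite (eq_bigr _ goodE) -big_enum /=.
rewrite -(big_map (fun J : {set 'I_z.+1} => \prod_(i in J) i)%N xpredT
  (fun m => m%:R^-1 : R)).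
apply: ler_sum_subset => [||m|m _]; rewrite ?iota_uniq ?invr_ge0 //.
  rewrite map_inj_in_uniq ?enum_uniq // => J J'.
  rewrite !mem_enum !inE => /andP[/forall_inP pJ _] /andP[/forall_inP pJ' _].
  exact: prod_prime_set_inj.
move/mapP => [J]; rewrite mem_enum inE => /andP[/forall_inP pJ JX] ->.
rewrite mem_index_iota ltnS JX andbT prodn_cond_gt0 // => i /pJ; exact: prime_gt0.
Qed.

Lemma mertens_product (R : realType) (z : nat) : (1 < z)%N ->
  \prod_(0 <= p < z.+1 | prime p) euler_factor R p <= 24 * ln z%:R.
Proof.
move=> z1.
(* r_p = (1 + 1/p) (1 - 1/p^2)^-1, and the product of (1 - 1/m^2)^-1 over
   2 <= m <= n is 2 n / (n + 1). *)
have telescope n : (0 < n)%N -> \prod_(0 <= p < n.+1 | prime p) euler_factor R p <=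
    (2 * n%:R / n.+1%:R) * \prod_(0 <= p < n.+1 | prime p) (p%:R^-1 + 1).
  elim: n => [//|[|n] IH _].
    have e (f : nat -> R) : \prod_(0 <= p < 2 | prime p) f p = 1.
      by rewrite big_mkcond !big_nat_recr //= big_geq // !mulr1.
    by rewrite !e !mulr1 divff.
  rewrite big_mkcond [X in _ <= _ * X]big_mkcond big_nat_recr //=.
  rewrite [X in _ <= _ * X]big_nat_recr //=.
  rewrite -big_mkcond -[X in _ <= _ * (X * _)]big_mkcond /=.
  move: (IH isT); set A := \prod_(_ <= _ < _ | _) _; set B := \prod_(_ <= _ < _ | _) _.
  have B0 : 0 <= B by apply: prodr_ge0 => i _; rewrite addr_ge0 // invr_ge0.
  have : 1 <= n.+1%:R :> R by rewrite ler1n.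
  case: ifP => pn; rewrite ?euler_factorE ?prime_gt1 //=
    -[n.+3%:R]natr1 -[n.+2%:R]natr1;
    move: n.+1%:R => q q1 AB.
    have -> : 2 * (q + 1) / (q + 1 + 1) * (B * ((q + 1)^-1 + 1)) =
       (2 * q / (q + 1) * B) * ((q + 1) / q) by field; rewrite ?gt_eqF //; lra.
    by rewrite ler_wpM2r // divr_ge0 //; lra.
  rewrite !mulr1; apply: (le_trans AB); rewrite ler_wpM2r //.
  rewrite ler_pdivrMr; last lra.
  rewrite mulrAC ler_pdivlMr; last lra.
  rewrite -subr_ge0.
  by have -> : 2 * (q + 1) * (q + 1) - 2 * q * (q + 1 + 1) = 2 by ring.
apply: (le_trans (telescope z (ltnW z1))).
(* As log z >= 1/2, one has 2 (2 + 8 log z) <= 24 log z. *)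
have := @prod_1D_prime_inv_le R z z1; have := @half_le_ln_nat R z z1.
set B := \prod_(_ <= _ < _ | _) _ => l1 lB.
have B0 : 0 <= B by apply: prodr_ge0 => i _; rewrite addr_ge0 // invr_ge0.
have : 2 * z%:R / z.+1%:R <= 2 :> R.
  by rewrite ler_pdivrMr // ler_pM2l // ler_nat.
move: (_ / _) => c c2; nra.
Qed.

(** * The contribution of the large primes *)

(** Up to [W], the weight (log p) / log (V + 2) >= 1/2 reduces the sum of 1/p to [sum_ln_prime_div];
    beyond [W], there are at most [c2 * W] primes, each with 1/p < 1/W. Using [V.+2] keeps the
    logarithm positive for every [V]. *)
Lemma euler_product_tail (R : realType) (F V W c1 c2 : nat) :
  (0 < W)%N -> (W <= V.+2 ^ c1)%N -> (size (primes F) <= c2 * W)%N ->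
  \prod_(p <- primes F | (V < p)%N) euler_factor R p <= expR (8 * c1%:R + 2 * c2%:R).
Proof.
move=> W0 WV FW.
have W0R : 0 < W%:R :> R by rewrite ltr0n.
have lV : 0 < ln (V.+2%:R : R) by rewrite ln_gt0 // ltr1n.
have prF p : p \in primes F -> prime p by rewrite mem_primes => /andP[].
apply: (@le_trans _ _ (\prod_(p <- primes F | (V < p)%N) expR (2 / p%:R))).
  rewrite big_seq_cond [leRHS]big_seq_cond; apply: ler_prod => p /andP[/prF pp _].
  rewrite euler_factor_le_expR ?prime_gt1 // andbT.
  by rewrite (le_trans _ (@euler_factor_ge1 R p (prime_gt1 pp))).
rewrite -expR_sum ler_expR.
pose S := \sum_(p <- primes F | (p <= W)%N) ln (p%:R : R) / p%:R.
have S_le : S <= 2 * ln W%:R.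
  apply: le_trans (@sum_ln_prime_div R W W0).
  rewrite /S -big_filter -[leRHS]big_filter; apply: ler_sum_subset => [||p|p _].
  - by rewrite filter_uniq ?primes_uniq.
  - by rewrite filter_uniq ?iota_uniq.
  - by rewrite !mem_filter mem_index_iota ltnS => /andP[-> /prF ->].
  by rewrite divr_ge0 ?ln_nat_ge0.
have lnW : ln (W%:R : R) <= c1%:R * ln V.+2%:R.
  rewrite mulr_natl -lnXn // -natrX ler_ln ?posrE ?ltr0n ?expn_gt0 //.
  by rewrite ler_nat.
(* For V < p <= W, V + 2 <= p^2 gives 2/p <= (4 / log (V + 2)) (log p) / p; for p > W, 2/p <=
   2/W. *)
apply: (@le_trans _ _ (4 / ln V.+2%:R * S + (size (primes F))%:R * (2 / W%:R))).
  have -> : (size (primes F))%:R * (2 / W%:R) = \sum_(p <- primes F) 2 / W%:R :> R.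
    by rewrite big_const_seq count_predT iter_addr_0 mulr_natl.
  rewrite /S mulr_sumr !(big_mkcond (fun p => (p <= W)%N)) -big_split /=.
  rewrite big_mkcond big_seq [leRHS]big_seq; apply: ler_sum => p /prF pp.
  have p0 : 0 < p%:R :> R by rewrite ltr0n prime_gt0.
  have lp := ln_nat_ge0 R p.
  case: ltnP => Vp; last first.
    rewrite addr_ge0 ?divr_ge0 //; case: ifP => // _.
    by rewrite mulr_ge0 ?divr_ge0 // ltW.
  case: leqP => pW; last first.
    by rewrite add0r ler_pM2l // lef_pV2 ?posrE // ler_nat ltnW.
  apply: ler_wpDr; first by rewrite divr_ge0.
  rewrite mulrA ler_wpM2r ?invr_ge0 ?(ltW p0) // mulrAC ler_pdivlMr //.
  have : ln (V.+2%:R : R) <= 2 * ln p%:R; last by lra.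
  rewrite mulr_natl -lnXn // -natrX ler_ln ?posrE ?ltr0n ?expn_gt0 ?(prime_gt0 pp) //.
  by rewrite ler_nat; have := prime_gt1 pp; nia.
rewrite lerD //.
  rewrite mulrAC ler_pdivrMr //; move: S_le lnW; move: (ln W%:R) (ln V.+2%:R) => lw lv.
  lra.
rewrite mulrCA ler_pM2l // ler_pdivrMr // -natrM ler_nat //.
Qed.

(** * Averages over complete residue systems *)

(** By the Chinese remainder theorem, x -> (x mod m, x mod n) is a bijection. *)
Lemma sum_mul_periodic (R : comRingType) (m n : nat) (u v : nat -> R) :
  (0 < m)%N -> (0 < n)%N -> coprime m n ->
  (forall x, u (x %% m)%N = u x) -> (forall x, v (x %% n)%N = v x) ->
  \sum_(0 <= x < m * n) u x * v x =
  (\sum_(0 <= x < m) u x) * (\sum_(0 <= x < n) v x).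
Proof.
move=> m0 n0 co pu pv; rewrite !big_mkord big_distrlr /= pair_big /=.
pose h (x : 'I_(m * n)) : 'I_m * 'I_n :=
  (Ordinal (ltn_pmod x m0), Ordinal (ltn_pmod x n0)).
have hi : injective h.
  move=> x y [/eqP xm /eqP xn]; apply/val_inj => /=.
  have : (x == y %[mod m * n])%N by rewrite chinese_remainder // xm xn.
  by rewrite !modn_small // => /eqP.
have hb : bijective h.
  by apply: inj_card_bij => //; rewrite card_prod !card_ord.
rewrite [RHS](reindex h) /=; last exact: onW_bij.
by apply: eq_bigr => x _; rewrite pu pv.
Qed.

Lemma sum_prod_periodic (R : comRingType) (s : seq nat) (u : nat -> nat -> R) :
  uniq s -> all prime s -> {in s, forall p x, u p (x %% p)%N = u p x} ->
  \sum_(0 <= x < \prod_(p <- s) p) \prod_(p <- s) u p x =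
  \prod_(p <- s) \sum_(0 <= x < p) u p x.
Proof.
elim: s => [|p s IH] /=; first by rewrite !big_nil big_nat1 big_nil.
move=> /andP[ps us] /andP[pp sp] per.
have per' : {in s, forall p x, u p (x %% p)%N = u p x}.
  by move=> q qs; apply: per; rewrite inE qs orbT.
have s0 : (0 < \prod_(q <- s) q)%N.
  by rewrite big_seq prodn_cond_gt0 // => q /(allP sp) /prime_gt0.
rewrite big_cons (eq_bigr (fun x => u p x * \prod_(q <- s) u q x)); last first.
  by move=> x _; rewrite big_cons.
rewrite sum_mul_periodic ?(prime_gt0 pp) //.
- by rewrite big_cons IH.
- rewrite prime_coprime //; apply: contra ps.
  rewrite (big_morph _ (fun m1 m2 => Euclid_dvdM m1 m2 pp) (Euclid_dvd1 pp)).
  rewrite big_has => /hasP[q qs].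
  by rewrite dvdn_prime2 // ?(allP sp) // => /eqP ->.
- by move=> x; apply: per; rewrite inE eqxx.
move=> x; apply: eq_big_seq => q qs; rewrite -[LHS]per' // -[RHS]per' //.
by rewrite modn_dvdm // (big_rem q) //= dvdn_mulr.
Qed.

(** The interval [0, N) is covered by N %/ P + 1 full periods, and [h] is nonnegative. *)
Lemma sum_periodic_le (R : realType) (P N : nat) (h : nat -> R) : (0 < P)%N ->
  (forall x, 0 <= h x) -> (forall x, h (x %% P)%N = h x) ->
  \sum_(0 <= x < N) h x <= (N %/ P).+1%:R * \sum_(0 <= x < P) h x.
Proof.
move=> P0 h0 per.
have NP : (N <= (N %/ P).+1 * P)%N by rewrite ltnW // ltn_ceil.
apply: (@le_trans _ _ (\sum_(0 <= x < (N %/ P).+1 * P) h x)).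
  by rewrite [leRHS](big_cat_nat (n := N)) //= lerDl sumr_ge0.
rewrite big_nat_mul (eq_bigr (fun=> \sum_(0 <= x < P) h x)); last first.
  move=> i _; rewrite -{1}[(i * P)%N]add0n big_addn mulSn addnK.
  by apply: eq_bigr => x _; rewrite -per addnC modnMDl per.
by rewrite big_const_nat iter_addr_0 subn0 mulr_natl.
Qed.

(** Telescoping, with 1 / (i + 1)^2 <= 1 / i - 1 / (i + 1). *)
Lemma sum_inv_sqr_le (R : realType) (m n : nat) : (0 < m)%N ->
  \sum_(m.+1 <= i < n.+1) ((i%:R : R) ^+ 2)^-1 <= m%:R^-1.
Proof.
move=> m0; case: (leqP n m) => [nm|mn].
  by rewrite big_geq ?ltnS // invr_ge0.
rewrite big_add1 /=.
apply: (@le_trans _ _ (\sum_(m <= i < n) (- i.+1%:R^-1 - - i%:R^-1))).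
  rewrite !big_nat; apply: ler_sum => i /andP[mi _].
  have : 1 <= i%:R :> R by rewrite ler1n; lia.
  rewrite -natr1; move: i%:R => q q1.
  have -> : - (q + 1)^-1 - - q^-1 = (q * (q + 1))^-1 by field; apply/andP; split; lra.
  by rewrite lef_pV2 ?posrE; nra.
rewrite telescope_sumr ?(ltnW mn) //.
by rewrite opprK addrC gerBl invr_ge0.
Qed.

(* For prime p, [hits c p x] says that p divides the product of the x - c i. *)
Definition hits {k : nat} (c : 'I_k -> int) (p x : nat) : bool :=
  [exists i, ((x%:Z - c i)%R \in dvdz p)].

Lemma hits_mod {k : nat} (c : 'I_k -> int) (p x : nat) : hits c p (x %% p) = hits c p x.
Proof.
apply: eq_existsb => i.
rewrite [in RHS](divn_eq x p) PoszD PoszM -addrA [RHS]rpredDl //.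
exact: dvdz_mull.
Qed.

(** Union bound: each [c i] is congruent to only one residue mod p. *)
Lemma sum_hits_le {k : nat} (c : 'I_k -> int) (p : nat) :
  (\sum_(0 <= x < p) hits c p x <= k)%N.
Proof.
rewrite big_mkord; have : (\sum_(x < p) hits c p x <=
    \sum_(x < p) \sum_(i < k) ((x%:Z - c i)%R \in dvdz p))%N.
  apply: leq_sum => x _; rewrite /hits; case: existsP => // [[i pi]].
  by rewrite (bigD1 i) //= pi.
move/leq_trans; apply; rewrite exchange_big /= -[leqRHS]card_ord -sum1_card.
apply: leq_sum => i _.
rewrite -big_mkcond sum1_card; apply/card_le1_eqP => x y.
rewrite !unfold_in /= => px py.
apply/val_inj => /=; apply/eqP.
have : x%:Z - y%:Z \in dvdz p.
  have -> : x%:Z - y%:Z = (x%:Z - c i) - (y%:Z - c i) by rewrite opprB addrA subrK.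
  exact: rpredB.
by rewrite -eqz_mod_dvd !modz_nat !modn_small ?ltn_ord // => /eqP [->].
Qed.

Lemma expR1_lt3 (R : realType) : expR (1 : R) < 3.
Proof.
have h := expR_ge1Dx (- 8^-1 : R).
have dbl (x : R) : expR (x + x) = expR x * expR x by rewrite expRD.
have e1 := dbl (- 8^-1); have e2 := dbl (- 8^-1 - 8^-1).
have e3 := dbl (- 8^-1 - 8^-1 + (- 8^-1 - 8^-1)).
have hlf : (- 8^-1 - 8^-1 + (- 8^-1 - 8^-1)) +
    (- 8^-1 - 8^-1 + (- 8^-1 - 8^-1)) = -1 :> R by lra.
rewrite hlf in e3.
(* Start from exp(-1/8) >= 7/8 and square three times; 13/17, 7/12 and 1/3 are rational lower bounds
   for the successive squares. *)
have h1 : 13 / 17 <= expR (- 8^-1 - 8^-1 : R) by rewrite e1; nra.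
have h2 : 7 / 12 <= expR (- 8^-1 - 8^-1 + (- 8^-1 - 8^-1) : R) by rewrite e2; nra.
have h3 : 1 / 3 < expR (-1 : R) by rewrite e3; nra.
by rewrite -[1]opprK expRN invf_plt ?posrE ?expR_gt0 //; lra.
Qed.

(** With v = s/p <= 1, the power is at most exp(2 v) <= 1 + 2 v exp(2 v), and exp(2 v) <= e^2 <
    9. *)
Lemma euler_factorX_le (R : realType) (p s : nat) :
  (1 < p)%N -> (s <= p)%N -> euler_factor R p ^+ s <= 1 + 18 * s%:R / p%:R.
Proof.
move=> p1 sp; have p0 : 0 < p%:R :> R by rewrite ltr0n; lia.
set v : R := s%:R / p%:R.
have v0 : 0 <= v by rewrite divr_ge0.
have v1 : v <= 1 by rewrite ler_pdivrMr // mul1r ler_nat.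
apply: (@le_trans _ _ (expR (2 * v))).
  have -> : 2 * v = s%:R * (2 / p%:R) by rewrite /v; field; rewrite gt_eqF.
  rewrite expRM_natl lerXn2r ?nnegrE ?expR_ge0 ?euler_factor_le_expR //.
  by rewrite (le_trans _ (@euler_factor_ge1 R p p1)).
have -> : 18 * s%:R / p%:R = 18 * v by rewrite /v mulrA.
have h := expR_ge1Dx (- (2 * v)).
have e9 : expR (2 * v) <= 9.
  apply: (@le_trans _ _ (expR (2%:R * 1))); first by rewrite ler_expR; lra.
  rewrite expRM_natl; have := expR1_lt3 R; have := expR_gt0 (1 : R); nra.
have : expR (2 * v) * expR (- (2 * v)) = 1 by rewrite -expRD subrr expR0.
move: h e9 (expR_gt0 (2 * v)); move: (expR _) (expR _) => A B; nra.
Qed.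

Lemma sum_prod_hits_le (R : realType) (k s K V N : nat) (c : 'I_k -> int) (y : R) :
  (0 < K)%N -> (k <= K)%N -> (s <= K)%N -> V`!%:R <= y -> N%:R <= 3 * y ->
  \sum_(0 <= x < N) \prod_(p <- index_iota K.+1 V.+1 | prime p)
     (if hits c p x then euler_factor R p ^+ s else 1) <=
  4 * expR (18 * s%:R) * y.
Proof.
move=> K0 kK sK Vy Ny.
pose Q := [seq p <- index_iota K.+1 V.+1 | prime p].
pose u p x : R := if hits c p x then euler_factor R p ^+ s else 1.
under eq_bigr => x _ do rewrite -big_filter -/Q.
have Qpr p : p \in Q -> [/\ prime p, (K < p)%N & (p <= V)%N].
  by rewrite mem_filter mem_index_iota ltnS => /and3P[].
have uQ : uniq Q by rewrite filter_uniq ?iota_uniq.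
have aQ : all prime Q by apply/allP => p /Qpr[].
have u1 p x : p \in Q -> 1 <= u p x.
  move=> /Qpr[/prime_gt1 p1 _ _]; rewrite /u; case: ifP => // _.
  by rewrite exprn_ege1 // euler_factor_ge1.
have u0 x : 0 <= \prod_(p <- Q) u p x.
  by rewrite big_seq prodr_ge0 // => p pQ; rewrite (le_trans _ (u1 p x pQ)).
pose P := (\prod_(p <- Q) p)%N.
have P0 : (0 < P)%N by rewrite /P big_seq prodn_cond_gt0 // => p /Qpr[/prime_gt0].
(* The elements of [Q] are distinct factors of V! = 1 2 ... V. *)
have PV : P%:R <= V`!%:R :> R.
  rewrite fact_prod /P !natr_prod; apply: ler_prod_subset => //.
  - exact: iota_uniq.
  - by move=> p /Qpr[_ Kp pV]; rewrite mem_index_iota ltnS pV andbT; lia.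
  by move=> p; rewrite mem_index_iota ler1n => /andP[].
have uper p x : u p (x %% p)%N = u p x by rewrite /u hits_mod.
apply: (le_trans (@sum_periodic_le R P N _ P0 u0 _)).
  move=> x; apply: eq_big_seq => q qs; rewrite -[LHS]uper -[RHS]uper.
  by rewrite modn_dvdm // /P (big_rem q) //= dvdn_mulr.
rewrite /P (@sum_prod_periodic _ _ _ uQ aQ) -/P; last by move=> p _ x; exact: uper.
have fac p : p \in Q -> 0 <= \sum_(0 <= x < p) u p x <=
    p%:R * expR (18 * s%:R * k%:R * (p%:R ^+ 2)^-1).
  move=> pQ; have [pp Kp pV] := Qpr p pQ; have p1 := prime_gt1 pp.
  have p0 : 0 < p%:R :> R by rewrite ltr0n prime_gt0.
  apply/andP; split.
    by apply: sumr_ge0 => x _; rewrite (le_trans _ (u1 p x pQ)).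
  pose g := euler_factor R p ^+ s - 1.
  have g0 : 0 <= g by rewrite subr_ge0 exprn_ege1 // euler_factor_ge1.
  have gle : g <= 18 * s%:R / p%:R.
    by rewrite lerBlDl; apply: euler_factorX_le p1 (leq_trans sK (ltnW Kp)).
  (* Each [u p x] is 1, plus [g] if [x] is one of the at most [k] residues that are hit. *)
  have -> : \sum_(0 <= x < p) u p x = p%:R + g * (\sum_(0 <= x < p) hits c p x)%N%:R.
    rewrite (eq_bigr (fun x => 1 + g * (hits c p x)%:R)).
      by rewrite big_split /= -mulr_sumr natr_sum big_const_nat iter_addr_0 subn0.
    move=> x _; rewrite /u /g.
    by case: ifP => _; rewrite ?mulr1 ?mulr0 ?addr0 // addrC subrK.
  have hk : (\sum_(0 <= x < p) hits c p x)%N%:R <= k%:R :> R.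
    by rewrite ler_nat sum_hits_le.
  apply: (@le_trans _ _ (p%:R + 18 * s%:R / p%:R * k%:R)).
    by rewrite lerD2l ler_pM.
  apply: (@le_trans _ _ (p%:R * (1 + 18 * s%:R * k%:R * (p%:R ^+ 2)^-1))); last first.
    by rewrite ler_pM2l // expR_ge1Dx.
  by rewrite le_eqVlt; apply/orP; left; apply/eqP; field; rewrite gt_eqF.
have prodle : \prod_(p <- Q) \sum_(0 <= x < p) u p x <= P%:R * expR (18 * s%:R).
  apply: (@le_trans _ _ (\prod_(p <- Q)
      (p%:R * expR (18 * s%:R * k%:R * (p%:R ^+ 2)^-1)))).
    by rewrite big_seq [leRHS]big_seq; apply: ler_prod => p; exact: fac.
  rewrite big_split /= -natr_prod ler_wpM2l // -expR_sum ler_expR -mulr_sumr.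
  rewrite -[leLHS]mulrA -[leRHS]mulr1 ler_wpM2l ?mulr_ge0 //.
  (* With k <= K, this reduces the exponent to 18 s. *)
  have : \sum_(p <- Q) ((p%:R : R) ^+ 2)^-1 <= K%:R^-1.
    apply: (le_trans _ (@sum_inv_sqr_le R K V K0)).
    apply: ler_sum_subset => // [|p]; first exact: iota_uniq.
    by rewrite mem_filter => /andP[].
  move/(ler_wpM2l (ler0n R k))/le_trans; apply.
  by rewrite ler_pdivrMr ?ltr0n // mul1r ler_nat.
apply: (le_trans (ler_wpM2l (ler0n R _) prodle)).
rewrite mulrA [leRHS]mulrAC ler_wpM2r ?expR_ge0 //.
(* Finally (N %/ P + 1) P <= N + P <= 3 y + V! <= 4 y. *)
rewrite -natrM mulSn natrD.
have : ((N %/ P * P)%N%:R : R) <= N%:R by rewrite ler_nat leq_trunc_div.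
lra.
Qed.

(** * Splitting the primes and bounding the sum for general parameters *)

(** [mertens_product] handles p <= K and [euler_product_tail] handles p > max(K, V); the middle
    range, empty if V <= K, is left for averaging. *)
Lemma totient_ratio_split (R : realType) (F K V W c1 c2 : nat) :
  (0 < F)%N -> (1 < K)%N -> (0 < W)%N -> (W <= V.+2 ^ c1)%N ->
  (size (primes F) <= c2 * W)%N ->
  totient_ratio R F <= 24 * ln K%:R * expR (8 * c1%:R + 2 * c2%:R) *
    \prod_(p <- primes F | (K < p <= V)%N) euler_factor R p.
Proof.
move=> F0 K1 W0 WV FW; rewrite totient_ratio_primes //.
have ge0 (P : pred nat) : 0 <= \prod_(p <- primes F | P p) euler_factor R p.
  by apply: le_trans ler01 _; exact: prod_euler_factor_ge1.
rewrite (bigID (fun p => (p <= K)%N)) /=.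
rewrite -mulrA; apply: ler_pM => //.
  apply: (le_trans _ (@mertens_product R K K1)).
  rewrite -[leLHS]big_filter -[leRHS]big_filter; apply: ler_prod_subset => [||p|p].
  - by rewrite filter_uniq ?primes_uniq.
  - by rewrite filter_uniq ?iota_uniq.
  - by rewrite !mem_filter mem_index_iota mem_primes ltnS => /andP[-> /andP[-> _]].
  by rewrite mem_filter => /andP[/prime_gt1 p1 _]; exact: euler_factor_ge1.
rewrite (bigID (fun p => (p <= V)%N)) /= mulrC; apply: ler_pM => //.
  apply: (le_trans _ (@euler_product_tail R F V W c1 c2 W0 WV FW)).
  rewrite -[leLHS]big_filter -[leRHS]big_filter; apply: ler_prod_subset => [||p|p].
  - by rewrite filter_uniq ?primes_uniq.
  - by rewrite filter_uniq ?primes_uniq.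
  - by rewrite !mem_filter -!ltnNge => /andP[/andP[_ ->] ->].
  rewrite mem_filter mem_primes => /andP[_ /andP[/prime_gt1 p1 _]].
  exact: euler_factor_ge1.
by under [leRHS]eq_bigl => p do rewrite ltnNge.
Qed.

Lemma absz_root_prod (k : nat) (bs : 'I_k -> int) (b : int) :
  `|root_prod bs b|%N = (\prod_(i < k) `|b - bs i|)%N.
Proof. exact: (big_morph absz abszM (erefl _)). Qed.

Lemma root_prod_gt0 (k : nat) (bs : 'I_k -> int) (b : int) :
  (forall i, b <> bs i) -> (0 < `|root_prod bs b|)%N.
Proof.
move=> nb; rewrite absz_root_prod; apply: prodn_gt0 => i.
by rewrite absz_gt0 subr_eq0; apply/eqP.
Qed.

(** The shift by [Y] lets the integers of [-Y, Y] be indexed by natural numbers, to which the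
    periodicity lemmas apply. *)
Lemma dvd_root_prod_hits (k : nat) (bs : 'I_k -> int) (p x Y : nat) :
  prime p -> (p %| `|root_prod bs (x%:Z - Y%:Z)|)%N ->
  hits (fun i => Y%:Z + bs i) p x.
Proof.
move=> pp; rewrite absz_root_prod.
rewrite (big_morph _ (fun m1 m2 => Euclid_dvdM m1 m2 pp) (Euclid_dvd1 pp)).
rewrite big_has => /hasP[i _ pi]; apply/existsP; exists i.
by rewrite opprD addrA; exact: pi.
Qed.

(** A number F with w prime divisors satisfies 2^w <= F, and here F <= (2 L)^k; take logarithms and
    use 1/2 <= log 2 <= 1. *)
Lemma size_primes_root_prod (R : realType) (k : nat) (bs : 'I_k -> int) (b : int)
    (L : R) :
  1 <= L -> `|b%:~R| <= L -> (forall i, `|(bs i)%:~R| <= L) -> (forall i, b <> bs i) ->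
  (size (primes `|root_prod bs b|))%:R <= 2 * k%:R * (1 + ln L).
Proof.
move=> L1 bL bsL nb; set F := `|_|%N.
have F0 : (0 < F)%N by exact: root_prod_gt0.
have FL : F%:R <= (2 * L) ^+ k.
  rewrite /F absz_root_prod natr_prod -[X in _ ^+ X](card_ord k) -prodr_const.
  apply: ler_prod => i _; rewrite ler0n /= natr_absz intr_norm rmorphB /=.
  by apply: (le_trans (ler_normB _ _)); have := bsL i; lra.
have F2 : (2 ^ size (primes F) <= F)%N.
  rewrite {2}(prod_prime_decomp F0) prime_decompE big_map /=.
  rewrite -(count_predT (primes F)) -(iter_muln_1) -big_const_seq.
  rewrite big_seq [leqRHS]big_seq; apply: leq_prod => p pF.
  move: (pF); rewrite -logn_gt0; move: pF; rewrite mem_primes => /andP[/prime_gt1 p1 _].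
  case: (logn p F) => // l _; rewrite expnS.
  by have : (0 < p ^ l)%N; [rewrite expn_gt0; lia | nia].
have L0 : 0 < L by lra.
have : ln ((2 : R) ^+ size (primes F)) <= ln ((2 * L) ^+ k).
  rewrite ler_ln ?posrE ?exprn_gt0 ?mulr_gt0 //.
  by apply: (le_trans _ FL); rewrite -natrX ler_nat.
rewrite lnXn // lnXn ?mulr_gt0 // lnM ?posrE // -[leLHS]mulr_natl -[leRHS]mulr_natl.
have := half_le_ln2 R; have := @le_ln1Dx R 1 ltac:(lra).
have -> : 1 + 1 = 2 :> R by lra.
have := ln_ge0 L1; move: (ln L) (ln 2) => l t.
have : 0 <= (size (primes F))%:R :> R by []. have : 0 <= k%:R :> R by [].
move: (size _)%:R k%:R => w q; nra.
Qed.

(** Both parts of the theorem are instances. In the constant, 96 = 24 * 4 comes from Mertens and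
    from averaging, 94 = 8 * 11 + 2 * 3 from the tail, and 18 from averaging. *)
Lemma totient_sum_le (R : realType) (k : nat) (bs : 'I_k -> int)
    (a s K V W : nat) (y : R) :
  (0 < a)%N -> (0 < s)%N -> (1 < K)%N -> 1 <= y ->
  (0 < W)%N -> (W <= V.+2 ^ 11)%N ->
  (forall b, `|b%:~R| <= y -> (forall i, b <> bs i) ->
     (size (primes `|root_prod bs b|) <= 3 * W)%N) ->
  (V <= K)%N \/ [/\ (k <= K)%N, (s <= K)%N & V`!%:R <= y] ->
  totient_sum bs a s y <=
    (96 * expR 94 * expR 18 * totient_ratio R a * ln K%:R) ^+ s * y.
Proof.
move=> a0 s0 K1 y1 W0 WV HW HV.
(* The integers of [-y, y] are the x - Y with 0 <= x < N, and N <= 2 y + 1 <= 3 y. *)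
pose Y := Num.truncn y; pose N := (Y.*2).+1.
have y0 : 0 <= y by lra.
have Yy : Y%:R <= y by rewrite truncn_le.
have Ny : N%:R <= 3 * y by rewrite /N -addnn -natr1 natrD; lra.
pose c (i : 'I_k) := Y%:Z + bs i.
pose h x : R := \prod_(p <- index_iota K.+1 V.+1 | prime p)
     (if hits c p x then euler_factor R p ^+ s else 1).
have hsum : \sum_(0 <= x < N) h x <= 4 * expR (18 * s%:R) * y.
  case: HV => [VK|[kK sK Vy]]; last first.
    by apply: sum_prod_hits_le => //; lia.
  rewrite (eq_bigr (fun=> 1)); last by move=> x _; rewrite /h big_geq ?ltnS.
  rewrite big_const_nat iter_addr_0 subn0; apply: (le_trans Ny).
  rewrite ler_wpM2r //.
  have : 1 <= expR (18 * s%:R) :> R.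
    by apply: (le_trans _ (expR_ge1Dx _)); rewrite lerDl mulr_ge0.
  lra.
have ra1 := @totient_ratio_ge1 R a a0.
have lK := @half_le_ln_nat R K K1.
pose C := totient_ratio R a * (24 * ln K%:R * expR 94).
have C0 : 0 <= C by rewrite !mulr_ge0 ?expR_ge0 //; lra.
pose bb (x : nat) := x%:Z - Y%:Z.
have pointwise x : bb x \in sum_range bs y ->
    totient_ratio R (a ^ k.+1 * `|root_prod bs (bb x)|)%N ^+ s <= C ^+ s * h x.
  rewrite inE => -[bxy nbx].
  have F0 := @root_prod_gt0 k bs _ nbx.
  set F := `|_|%N in F0 *.
  have Fge P : 0 <= \prod_(p <- primes F | P p) euler_factor R p.
    by apply: le_trans ler01 _; exact: prod_euler_factor_ge1.
  apply: (@le_trans _ _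
    ((C * \prod_(p <- primes F | (K < p <= V)%N) euler_factor R p) ^+ s)).
    rewrite lerXn2r ?nnegrE ?divr_ge0 ?(mulr_ge0 C0 (Fge _)) //.
    have aX0 : (0 < a ^ k.+1)%N by rewrite expn_gt0 a0.
    apply: (le_trans (@totient_ratioM R _ _ aX0 F0)).
    rewrite totient_ratioX // /C -[leRHS]mulrA ler_wpM2l //; first lra.
    have := @totient_ratio_split R F K V W 11 3 F0 K1 W0 WV (HW _ bxy nbx).
    by rewrite (_ : 8 * 11%:R + 2 * 3%:R = 94 :> R) //; lra.
  rewrite exprMn ler_wpM2l ?exprn_ge0 // /h -prodrXl.
  rewrite -[leRHS]big_mkcondr -[leLHS]big_filter -[leRHS]big_filter.
  apply: ler_prod_subset => [||p|p].
  - by rewrite filter_uniq ?primes_uniq.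
  - by rewrite filter_uniq ?iota_uniq.
  - rewrite !mem_filter mem_index_iota ltnS mem_primes => /and3P[-> pp /andP[_ pF]].
    by rewrite pp dvd_root_prod_hits.
  rewrite mem_filter => /andP[/andP[/prime_gt1 p1 _] _].
  by rewrite exprn_ege1 ?euler_factor_ge1.
have sumle : totient_sum bs a s y <= C ^+ s * \sum_(0 <= x < N) h x.
  (* A duplicate-free enumeration of the index set, which turns the finitely supported sum into a
     sum over a list. *)
  pose r := [seq b <- [seq bb x | x <- index_iota 0 N] | b \in sum_range bs y].
  rewrite /totient_sum (@fsbigE _ _ _ _ _ r).
  - rewrite big_filter_cond big_map mulr_sumr big_mkcond; apply: ler_sum => x _ /=.
    case: ifP => [/andP[xA _]|_]; first exact: pointwise.
    rewrite mulr_ge0 ?exprn_ge0 // prodr_ge0 // => p pp; case: ifP => // _.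
    by rewrite exprn_ge0 // (le_trans _ (@euler_factor_ge1 R p (prime_gt1 pp))).
  - by rewrite filter_uniq // map_inj_uniq ?iota_uniq // => u v /addIr [].
  - move=> b br; have : b \in r by exact: br.
    by rewrite mem_filter => /andP[]; rewrite inE.
  move=> b bA; rewrite mem_filter negb_and => /orP[/negP[]|]; first by rewrite inE.
  case: bA => by_ _ /negP[].
  have bY : (`|b| <= Y)%N by rewrite truncn_ge_nat // natr_absz intr_norm.
  apply/mapP; exists `|(b + Y%:Z)%R|%N;
    rewrite ?mem_index_iota /bb /N -?addnn; move: bY; clear; lia.
apply: (le_trans sumle).
apply: (le_trans (ler_wpM2l (exprn_ge0 s C0) hsum)).
rewrite mulrA ler_wpM2r //.
have -> : 96 * expR 94 * expR 18 * totient_ratio R a * ln K%:R = C * (4 * expR 18) :> R.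
  by rewrite /C; ring.
(* The factor 4 fits into the [s]-th power because 4 <= 4^s for s >= 1. *)
rewrite [leRHS]exprMn ler_wpM2l ?exprn_ge0 // [leRHS]exprMn [18 * _]mulrC expRM_natl.
rewrite ler_wpM2r ?exprn_ge0 ?expR_ge0 //.
by rewrite -[leLHS]expr1 ler_weXn2l // ler1n.
Qed.

(** * Choice of parameters and conclusion *)

(** Provides [V] near sqrt(M / 10): small enough for exp(V^2) <= exp(l / 10), large enough for a
    power of [V.+2] to exceed (M + 1)^2. *)
Lemma sqrt_tenth (M : nat) : exists V : nat, (10 * V ^ 2 <= M < 10 * V.+1 ^ 2)%N.
Proof.
elim: M => [|M [V /andP[VM MV]]]; first by exists 0%N.
case: (ltnP M.+1 (10 * V.+1 ^ 2)) => h; first by exists V; rewrite h andbT; lia.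
by exists V.+1; rewrite h /= (_ : M.+1 = 10 * V.+1 ^ 2)%N; nia.
Qed.

(** V! <= V^V <= (exp V)^V. *)
Lemma fact_le_expR (R : realType) (V : nat) : V`!%:R <= expR (V ^ 2)%:R :> R.
Proof.
apply: (@le_trans _ _ (V ^ V)%N%:R); first by rewrite ler_nat leq_fact_exp.
rewrite natrX -mulnn natrM expRM_natl lerXn2r ?nnegrE ?expR_ge0 //.
by apply: (le_trans _ (expR_ge1Dx _)); rewrite lerDr.
Qed.

Theorem theorem1p4 (R : realType) :
  exists c : R, 0 < c /\
    forall (k : nat) (bs : 'I_k -> int) (a s : nat) (x eta : R),
      injective bs -> (0 < a)%N -> (0 < s)%N -> (2 <= k)%N -> 3 <= x ->
      ln x `^ (- (9 / 10)) <= eta -> eta <= 1 ->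
      (forall i, `|(bs i)%:~R| <= ln x) ->
      (ln (ln x) <= k%:R \/ (s <= k)%N ->
        totient_sum bs a s (eta * ln x)
          <= (c * totient_ratio R a * ln k%:R) ^+ s * (eta * ln x)) /\
      (k%:R < ln (ln x) -> (k < s)%N ->
        totient_sum bs a s (eta * ln x)
          <= (c * totient_ratio R a * ln s%:R) ^+ s * (eta * ln x)).
Proof.
exists (96 * expR 94 * expR 18); split; first by rewrite !mulr_gt0 ?expR_gt0.
move=> k bs a s x eta _ a0 s0 k2 x3 etaL eta1 bsL.
have L1 : 1 <= ln x.
  rewrite -[leLHS](expRK 1) ler_ln ?posrE ?expR_gt0 //; last lra.
  by have := expR1_lt3 R; lra.
have L0 : 0 < ln x by lra.
pose l := ln (ln x).
have l0 : 0 <= l by rewrite ln_ge0.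
(* The lower bound on [eta] is exp(-(9/10) l), and log x = exp l. *)
have yl : expR (l / 10) <= eta * ln x.
  have -> : l / 10 = - (9 / 10) * l + l by lra.
  rewrite expRD [expR l]lnK ?posrE // ler_wpM2r ?(ltW L0) //.
  by move: etaL; rewrite /powR gt_eqF.
have y1 : 1 <= eta * ln x.
  by apply: (le_trans _ yl); rewrite -expR0 ler_expR divr_ge0.
have yL : eta * ln x <= ln x by rewrite ler_piMl // ltW.
have omega b : `|b%:~R| <= eta * ln x -> (forall i, b <> bs i) ->
    (size (primes `|root_prod bs b|))%:R <= 2 * k%:R * (1 + l).
  by move=> by_ nb; apply: size_primes_root_prod => //; exact: le_trans yL.
have small : l <= k%:R -> totient_sum bs a s (eta * ln x)
    <= (96 * expR 94 * expR 18 * totient_ratio R a * ln k%:R) ^+ s * (eta * ln x).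
  move=> lk; apply: (@totient_sum_le R k bs a s k k (k ^ 2)) => //.
  - by rewrite expn_gt0 (ltnW k2).
  - apply: (@leq_trans (k.+2 ^ 2)); first by rewrite leq_exp2r ?(leqW (leqnSn k)).
    by rewrite leq_exp2l.
  (* Here 2 k (1 + l) <= 2 k (1 + k) <= 3 k^2, as k >= 2. *)
  - move=> b by_ nb; rewrite -(ler_nat R); apply: (le_trans (omega b by_ nb)).
    apply: (@le_trans _ _ (2 * k * (1 + k))%N%:R); last first.
      by rewrite ler_nat -mulnn; move: k2; clear -k; nia.
    by rewrite natrM natrM natrD ler_wpM2l ?mulr_ge0 // lerD2l.
  by left.
(* [K] stays free: it is [k] in the first part when s <= k < l, and [s] in the second. *)
have large K : k%:R < l -> (k <= K)%N -> (s <= K)%N ->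
    totient_sum bs a s (eta * ln x)
    <= (96 * expR 94 * expR 18 * totient_ratio R a * ln K%:R) ^+ s * (eta * ln x).
  move=> kl kK sK; pose M := Num.truncn l.
  have Ml : M%:R <= l by rewrite truncn_le.
  have lM : l < M.+1%:R by rewrite truncnS_gt.
  have kM : (k <= M)%N by rewrite truncn_ge_nat // ltW.
  have [V /andP[VM MV]] := sqrt_tenth M.
  apply: (@totient_sum_le R k bs a s K V (M.+1 ^ 2)) => //.
  - exact: leq_trans k2 kK.
  (* M.+1 <= 10 V.+1^2, whence M.+1^2 <= 2^7 V.+1^4 *)
  - rewrite (_ : 11 = 7 + 4)%N // expnD.
    apply: (@leq_trans ((10 * V.+1 ^ 2) ^ 2)); first by rewrite leq_exp2r.
    rewrite expnMn -expnM; apply: leq_mul; last by rewrite leq_exp2r.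
    by apply: (@leq_trans (2 ^ 7)) => //; rewrite leq_exp2r.
  (* Here k <= M and l < M + 1, so 2 k (1 + l) <= 2 M (M + 2) <= 3 (M + 1)^2. *)
  - move=> b by_ nb; rewrite -(ler_nat R); apply: (le_trans (omega b by_ nb)).
    apply: (@le_trans _ _ (2 * M * (1 + M.+1))%N%:R); last first.
      by rewrite ler_nat -mulnn; clear -M; nia.
    rewrite natrM natrM natrD ler_pM ?mulr_ge0 ?addr_ge0 //.
      by rewrite ler_pM2l // ler_nat.
    by rewrite lerD2l ltW.
  (* V! <= exp(V^2) <= exp(l / 10) <= y, since 10 V^2 <= M <= l. *)
  right; split=> //; apply: (le_trans (fact_le_expR R V)); apply: (le_trans _ yl).
  rewrite ler_expR ler_pdivlMr // -natrM mulnC.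
  by apply: (le_trans _ Ml); rewrite ler_nat.
split=> [[//|sk]|kl ks]; last by apply: large => //; exact: ltnW.
by case: (leP l k%:R) => [//|kl]; exact: large.
Qed.
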